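(* Let $N$ be an $n$-dimensional proper slant submanifold of a Kaehlerian manifold $(M,g,J)$. Then the $2$-form $\Lambda$ on $N$ defined by $\Lambda(X,Y)=\langle X,PY\rangle$ is closed, that is, $d\Lambda=0$. Hence $\Lambda$ defines a canonical cohomology class of $N$: $[\Lambda]\in H^2(N;{\bf R})$. In particular, $(N,\Lambda)$ is a symplectic manifold.
   Context: For $X$ tangent to $N$, $PX$ denotes the tangential component of $JX$. $N$ is slant if, for nonzero $X\in T_xN$, the angle between $JX$ and $T_xN$ is a constant $\theta$ independent of $x\in N$ and of $X$; proper slant if $\theta\neq0,\pi/2$. A symplectic manifold is an even-dimensional manifold with a non-degenerate closed $2$-form. *)

(* Defs.v *)
From mathcomp Require Export all_boot all_order all_algebra.
From mathcomp Require Export all_classical all_reals all_analysis.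
Export numFieldNormedType.Exports.

Set Implicit Arguments.
Unset Strict Implicit.
Unset Printing Implicit Defensive.

Import Order.TTheory GRing.Theory Num.Theory.
Local Open Scope classical_set_scope.
Local Open Scope ring_scope.

Definition partial (R : realType) (n : nat) (W : normedModType R) (i : 'I_n)
    (f : 'rV[R]_n -> W) : 'rV[R]_n -> W :=
  fun u => 'D_(delta_mx 0 i) f u.

(* Only meant for open [U]: a map is C^(k+1) iff it is differentiable and all
   its first partial derivatives are C^k. *)
Fixpoint Ck_on (R : realType) (n : nat) (W : normedModType R) (k : nat)
    (U : set 'rV[R]_n) (f : 'rV[R]_n -> W) : Prop :=
  if k is k'.+1 then
    (forall u, U u -> differentiable f u) /\
    (forall i : 'I_n, Ck_on k' U (partial i f))
  else forall u, U u -> {for u, continuous f}.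

Definition smooth_on (R : realType) (n : nat) (W : normedModType R)
    (U : set 'rV[R]_n) (f : 'rV[R]_n -> W) : Prop :=
  forall k, Ck_on k U f.

(* [cmap] only matters on [cdom], and [cinv] only on [cmap @` cdom]. *)
Record chart (R : realType) (n : nat) (T : topologicalType) := Chart {
  cdom : set T;
  cmap :> T -> 'rV[R]_n;
  cinv : 'rV[R]_n -> T }.

Definition cimage (R : realType) (n : nat) (T : topologicalType)
  (c : chart R n T) : set 'rV[R]_n := c @` cdom c.

Definition is_chart (R : realType) (n : nat) (T : topologicalType)
    (c : chart R n T) : Prop :=
  [/\ open (cdom c), open (cimage c),
      forall x, cdom c x -> cinv c (c x) = x,
      forall x, cdom c x -> {for x, continuous c}
    & forall u, cimage c u -> {for u, continuous (cinv c)}].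

Definition smooth_transition (R : realType) (n : nat) (T : topologicalType)
    (c c' : chart R n T) : Prop :=
  smooth_on (c @` (cdom c `&` cdom c')) (c' \o cinv c).

(* [chart_at x] is an arbitrary choice of a chart around [x]; it serves to
   identify the tangent space at [x] with R^n. *)
Record manifold (R : realType) (n : nat) := Manifold {
  carrier :> topologicalType;
  atlas : set (chart R n carrier);
  chart_at : carrier -> chart R n carrier;
  _ : [set: carrier] !=set0;
  _ : hausdorff_space carrier;
  _ : @second_countable carrier;
  _ : forall c, atlas c -> is_chart c;
  _ : forall c c', atlas c -> atlas c' -> smooth_transition c c';
  _ : forall x, atlas (chart_at x);
  _ : forall x, cdom (chart_at x) x }.

(* A tangent vector at [x] is given by its coordinates in [chart_at x]. *)
Definition tangent (R : realType) (n : nat) (M : manifold R n) (x : M) :=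
  'rV[R]_n.

Definition coord (R : realType) (n : nat) (M : manifold R n)
    (c : chart R n M) (x : M) (v : tangent x) : 'rV[R]_n :=
  'd (c \o cinv (chart_at x)) (chart_at x x) v.

(* The coordinate vector d/dx_i at [x] of the chart [c]. *)
Definition coord_vec (R : realType) (n : nat) (M : manifold R n)
    (c : chart R n M) (x : M) (i : 'I_n) : tangent x :=
  'd (chart_at x \o cinv c) (c x) (delta_mx 0 i : 'rV[R]_n).

Definition field1 (R : realType) (n : nat) (M : manifold R n) :=
  forall x : M, tangent x -> R.
Definition field2 (R : realType) (n : nat) (M : manifold R n) :=
  forall x : M, tangent x -> tangent x -> R.
Definition field3 (R : realType) (n : nat) (M : manifold R n) :=
  forall x : M, tangent x -> tangent x -> tangent x -> R.
Definition field11 (R : realType) (n : nat) (M : manifold R n) :=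
  forall x : M, tangent x -> tangent x.

Definition comp1 (R : realType) (n : nat) (M : manifold R n)
    (c : chart R n M) (a : field1 M) (i : 'I_n) (u : 'rV[R]_n) : R :=
  a (cinv c u) (coord_vec c (cinv c u) i).

Definition comp2 (R : realType) (n : nat) (M : manifold R n)
    (c : chart R n M) (w : field2 M) (i j : 'I_n) (u : 'rV[R]_n) : R :=
  w (cinv c u) (coord_vec c (cinv c u) i) (coord_vec c (cinv c u) j).

(* J (d/dx_j) = \sum_l (comp11 c J l j) d/dx_l *)
Definition comp11 (R : realType) (n : nat) (M : manifold R n)
    (c : chart R n M) (J : field11 M) (l j : 'I_n) (u : 'rV[R]_n) : R :=
  coord c (J (cinv c u) (coord_vec c (cinv c u) j)) 0 l.

Definition one_form (R : realType) (n : nat) (M : manifold R n)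
    (a : field1 M) : Prop :=
  (forall x : M, scalar (a x)) /\
  (forall c, atlas c -> forall i,
     smooth_on (W := R^o) (cimage c) (comp1 c a i)).

Definition bilinear_field (R : realType) (n : nat) (M : manifold R n)
    (w : field2 M) : Prop :=
  forall (x : M) (v : tangent x), scalar (w x v) /\ scalar (w x ^~ v).

Definition smooth_field2 (R : realType) (n : nat) (M : manifold R n)
    (w : field2 M) : Prop :=
  forall c, atlas c -> forall i j,
    smooth_on (W := R^o) (cimage c) (comp2 c w i j).

Definition two_form (R : realType) (n : nat) (M : manifold R n)
    (w : field2 M) : Prop :=
  [/\ bilinear_field w, smooth_field2 w
    & forall (x : M) (v : tangent x), w x v v = 0].

Definition extd1 (R : realType) (n : nat) (M : manifold R n)
    (a : field1 M) : field2 M := fun x X Y =>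
  let c := chart_at x in
  \sum_(i < n) \sum_(j < n) (X 0 i * Y 0 j *
    (partial (W := R^o) i (comp1 c a j) (c x)
     - partial (W := R^o) j (comp1 c a i) (c x))).

Definition extd2 (R : realType) (n : nat) (M : manifold R n)
    (w : field2 M) : field3 M := fun x X Y Z =>
  let c := chart_at x in
  \sum_(i < n) \sum_(j < n) \sum_(k < n) (X 0 i * Y 0 j * Z 0 k *
    (partial (W := R^o) i (comp2 c w j k) (c x)
     + partial (W := R^o) j (comp2 c w k i) (c x)
     + partial (W := R^o) k (comp2 c w i j) (c x))).

Definition closed_two_form (R : realType) (n : nat) (M : manifold R n)
    (w : field2 M) : Prop :=
  two_form w /\ forall (x : M) (X Y Z : tangent x), extd2 w X Y Z = 0.

(* De Rham classes of degree 2, as cosets modulo the exact forms. *)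
Definition dR_class2 (R : realType) (n : nat) (M : manifold R n)
    (w : field2 M) : set (field2 M) :=
  [set w' | closed_two_form w' /\
    exists2 a : field1 M, one_form a &
      forall (x : M) (X Y : tangent x), w' x X Y - w x X Y = extd1 a X Y].

Definition dR_H2 (R : realType) (n : nat) (M : manifold R n) :
    set (set (field2 M)) :=
  (@dR_class2 R n M) @` [set w | closed_two_form w].

Definition symplectic (R : realType) (n : nat) (M : manifold R n)
    (w : field2 M) : Prop :=
  [/\ ~~ odd n, closed_two_form w
    & forall (x : M) (X : tangent x), (forall Y, w x X Y = 0) -> X = 0].

Definition riemannian_metric (R : realType) (n : nat) (M : manifold R n)
    (g : field2 M) : Prop :=
  [/\ bilinear_field g, smooth_field2 g,
      forall (x : M) (v w : tangent x), g x v w = g x w v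
    & forall (x : M) (v : tangent x), v != 0 -> 0 < g x v v].

Definition almost_complex (R : realType) (n : nat) (M : manifold R n)
    (J : field11 M) : Prop :=
  [/\ forall x : M, linear (J x),
      forall c, atlas c -> forall l j,
        smooth_on (W := R^o) (cimage c) (comp11 c J l j)
    & forall (x : M) (v : tangent x), J x (J x v) = - v].

(* The Christoffel symbol Gamma^l_ij of the Levi-Civita connection of [g]. *)
Definition christoffel (R : realType) (n : nat) (M : manifold R n)
    (g : field2 M) (c : chart R n M) (l i j : 'I_n) (u : 'rV[R]_n) : R :=
  2^-1 * \sum_(k < n)
    (invmx (\matrix_(a < n, b < n) comp2 c g a b u) l k *
      (partial (W := R^o) i (comp2 c g k j) u
       + partial (W := R^o) j (comp2 c g k i) u
       - partial (W := R^o) k (comp2 c g i j) u)).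

(* The d/dx_l component of (nabla_(d/dx_i) J) (d/dx_j). *)
Definition nabla11 (R : realType) (n : nat) (M : manifold R n)
    (g : field2 M) (J : field11 M) (c : chart R n M) (i l j : 'I_n)
    (u : 'rV[R]_n) : R :=
  partial (W := R^o) i (comp11 c J l j) u
  + \sum_(k < n) (christoffel g c l i k u * comp11 c J k j u
                  - christoffel g c k i j u * comp11 c J l k u).

Definition kaehler (R : realType) (n : nat) (M : manifold R n)
    (g : field2 M) (J : field11 M) : Prop :=
  [/\ riemannian_metric g, almost_complex J,
      forall (x : M) (v w : tangent x), g x (J x v) (J x w) = g x v w
    & forall c, atlas c -> forall u, cimage c u ->
        forall i l j, nabla11 g J c i l j u = 0].

Definition tmap (R : realType) (n m : nat) (N : manifold R n)
    (M : manifold R m) (f : N -> M) (x : N) (X : tangent x) : tangent (f x) :=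
  'd (chart_at (f x) \o f \o cinv (chart_at x)) (chart_at x x) X.

Definition smooth_map (R : realType) (n m : nat) (N : manifold R n)
    (M : manifold R m) (f : N -> M) : Prop :=
  continuous f /\
  forall c c', atlas c -> atlas c' ->
    smooth_on (c @` (cdom c `&` f @^-1` cdom c')) (c' \o f \o cinv c).

Definition immersion (R : realType) (n m : nat) (N : manifold R n)
    (M : manifold R m) (f : N -> M) : Prop :=
  smooth_map f /\ forall x : N, injective (@tmap R n m N M f x).

Definition angle (R : realType) (m : nat) (M : manifold R m) (g : field2 M)
    (x : M) (v w : tangent x) : R :=
  acos (g x v w / (Num.sqrt (g x v v) * Num.sqrt (g x w w))).

Definition angle_subspace (R : realType) (m : nat) (M : manifold R m)
    (g : field2 M) (x : M) (v : tangent x) (W : set (tangent x)) : R :=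
  inf [set angle g v w | w in [set w | W w /\ w != 0]].

Definition slant (R : realType) (n m : nat) (N : manifold R n)
    (M : manifold R m) (g : field2 M) (J : field11 M) (f : N -> M)
    (theta : R) : Prop :=
  forall (x : N) (X : tangent x), X != 0 ->
    angle_subspace g (J (f x) (tmap f X)) (range (@tmap R n m N M f x)) = theta.

Definition proper_slant (R : realType) (n m : nat) (N : manifold R n)
    (M : manifold R m) (g : field2 M) (J : field11 M) (f : N -> M) : Prop :=
  exists theta : R, [/\ slant g J f theta, theta != 0 & theta != pi / 2].

Definition induced_metric (R : realType) (n m : nat) (N : manifold R n)
    (M : manifold R m) (g : field2 M) (f : N -> M) : field2 N :=
  fun x X Y => g (f x) (tmap f X) (tmap f Y).

(* The vector [Y] of T_x N such that [v - df Y] is normal to N. *)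
Definition tangential_component (R : realType) (n m : nat) (N : manifold R n)
    (M : manifold R m) (g : field2 M) (f : N -> M) (x : N)
    (v : tangent (f x)) : tangent x :=
  get [set Y : 'rV[R]_n |
    forall Z : tangent x, g (f x) (v - tmap f (Y : tangent x)) (tmap f Z) = 0].

Definition slantP (R : realType) (n m : nat) (N : manifold R n)
    (M : manifold R m) (g : field2 M) (J : field11 M) (f : N -> M) :
    field11 N :=
  fun x X => tangential_component g (J (f x) (tmap f X)).

Definition slant_form (R : realType) (n m : nat) (N : manifold R n)
    (M : manifold R m) (g : field2 M) (J : field11 M) (f : N -> M) :
    field2 N :=
  fun x X Y => induced_metric g f X (slantP g J f Y).

(* Main.v *)
Require Import Defs.
From mathcomp Require Import ring.

(* The fundamental form g(v, J w) of a Kaehler manifold is parallel for a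
   symmetric connection, hence closed.  As <X, PY> = <X, JY> for X, Y tangent
   to N, Lambda is the pullback of the fundamental form under the immersion;
   exterior derivatives commute with pullbacks by symmetry of second
   derivatives.  If Lambda(X, .) = 0 then JX is normal to N, so the slant angle
   would be pi/2 unless X = 0; a nondegenerate alternating form exists only in
   even dimension. *)

Set Implicit Arguments.
Unset Strict Implicit.
Unset Printing Implicit Defensive.
Import Order.TTheory GRing.Theory Num.Theory.
Local Open Scope classical_set_scope.
Local Open Scope ring_scope.

(** * C^k functions and symmetry of second derivatives *)

(** A tangent vector at [x] is a row of coordinates in [chart_at x], a chart chosen arbitrarily at
    each point, so nothing can be differentiated in that frame. Derivatives are therefore taken of
    components in the frame [coord_vec c] of one fixed chart, and the geometry becomes three
    identities between indexed families over a commutative ring ([parallel_form],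
    [parallel_form_closed], [pullback_closed]), into which metric, Christoffel symbols and partial
    derivatives are substituted. The frames on [N] and [M] are tied together by [tmap_coord_vec].
    The operator [slantP] is picked by [get], which carries no regularity; [slant_formE] removes it,
    and smoothness of Lambda then comes from the fundamental form and the local representative of
    [f]. *)

Lemma near_eq_diff (R : numFieldType) (V W : normedModType R) (f g : V -> W)
    (x : V) : {near x, f =1 g} -> differentiable f x ->
  differentiable g x /\ 'd g x = 'd f x :> (V -> W).
Proof.
move=> fg df.
have cf : continuous ('d f x) by exact: diff_continuous.
have gE : g \o shift x = cst (g x) + 'd f x +o_ 0 id.
  apply/eqaddoP => e e0; have /eqaddoP/(_ e e0) := diff_locally df.
  have : \forall h \near (0 : V), f (h + x) = g (h + x).
    by move: fg; rewrite (near_shift 0); apply: filterS => h; rewrite /= subr0.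
  apply: filterS2 => h /= fgh.
  by rewrite !fctE /= /cst /= fgh (nbhs_singleton fg).
have dE : 'd g x = 'd f x :> (V -> W) by exact: diff_unique.
split=> [|//]; apply/diff_locallyP; split; first by rewrite dE; exact: cf.
by rewrite dE; exact: gE.
Qed.

(** Chart changes compose as expected only near a point, hence the local hypothesis on [h]. The
    separate name [y] lets [p x] be replaced by a simpler expression of the same point. *)
Lemma diff_comp_near (R : numFieldType) (U V W : normedModType R)
    (p : U -> V) (q : V -> W) (h : U -> W) (x : U) (y : V) :
  p x = y -> differentiable p x -> differentiable q y ->
  {near x, q \o p =1 h} -> 'd h x = 'd q y \o 'd p x :> (U -> W).
Proof.
move=> <- dp dq /near_eq_diff[|_ ->]; first exact: differentiable_comp.
exact: diff_comp.
Qed.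

Lemma near_eq_continuous (T U : topologicalType) (f g : T -> U) (x : T) :
  {near x, f =1 g} -> {for x, continuous f} -> {for x, continuous g}.
Proof.
move=> fg; rewrite /prop_for /continuous_at (nbhs_singleton fg) => cf.
exact: (cvg_trans (near_eq_cvg fg) cf).
Qed.

Section Ck.
Context {R : realType} {n : nat}.

(** Each clause of [Ck_on] concerns one point at a time and uses ambient derivatives, so the sets
    [V] may be arbitrary. *)
Lemma Ck_on_local (W : normedModType R) k (U : set 'rV[R]_n) (f : 'rV[R]_n -> W) :
  (forall u, U u -> exists2 V : set 'rV[R]_n, V u & Ck_on k V f) -> Ck_on k U f.
Proof.
elim: k f => [|k IH] f /= loc.
  by move=> u /loc[V Vu]; apply.
split=> [u /loc[V Vu []]|i]; first by move=> df _; exact: df.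
by apply: IH => u /loc[V Vu [_ Cf]]; exists V.
Qed.

Lemma near_eq_partial (W : normedModType R) (U : set 'rV[R]_n)
    (f g : 'rV[R]_n -> W) i :
  open U -> {in U, f =1 g} -> {in U, partial i f =1 partial i g}.
Proof.
move=> oU fg u /set_mem Uu; apply: near_eq_derive.
have : \forall v \near u, U v by exact: open_nbhs_nbhs.
by apply: filterS => v Uv; apply: fg; exact: mem_set.
Qed.

Lemma Ck_on_ext (W : normedModType R) k (U : set 'rV[R]_n) (f g : 'rV[R]_n -> W) :
  open U -> {in U, f =1 g} -> Ck_on k U f -> Ck_on k U g.
Proof.
move=> oU; elim: k f g => [|k IH] f g fg /=.
  move=> Cf u Uu.
  have fgu : {near u, f =1 g}.
    have : \forall v \near u, U v by exact: open_nbhs_nbhs.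
    by apply: filterS => v Uv; apply: fg; exact: mem_set.
  exact: near_eq_continuous (Cf u Uu).
case=> df Cf; split=> [u Uu|i]; last first.
  by apply: IH (Cf i); exact: near_eq_partial.
have fgu : {near u, f =1 g}.
  have : \forall v \near u, U v by exact: open_nbhs_nbhs.
  by apply: filterS => v Uv; apply: fg; exact: mem_set.
by have [] := near_eq_diff fgu (df u Uu).
Qed.

(** The product and chain rules pair derivatives with undifferentiated factors, whose order must be
    lowered by one before an induction hypothesis applies to both. *)
Lemma Ck_onS (W : normedModType R) k (U : set 'rV[R]_n) (f : 'rV[R]_n -> W) :
  Ck_on k.+1 U f -> Ck_on k U f.
Proof.
elim: k f => [|k IH] f; last first.
  by case=> df Cf; split=> // i; apply: IH; exact: Cf.
by case=> df _ u Uu; apply: differentiable_continuous; exact: df.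
Qed.

Lemma Ck_on_cst (W : normedModType R) k (U : set 'rV[R]_n) (a : W) :
  Ck_on k U (fun=> a).
Proof.
elim: k a => [|k IH] a.
  by move=> u _; apply: (@cst_continuous _ _ a).
split=> [u _|i]; first exact: (@differentiable_cst _ _ W a).
suff -> : partial i (fun=> a) = fun=> 0 :> W by exact: IH.
by apply/funext => u; exact: (@derive_cst _ _ W).
Qed.

Lemma Ck_onD (W : normedModType R) k (U : set 'rV[R]_n) (f g : 'rV[R]_n -> W) :
  open U -> Ck_on k U f -> Ck_on k U g -> Ck_on k U (f \+ g).
Proof.
move=> oU; elim: k f g => [|k IH] f g /=.
  by move=> Cf Cg u Uu; apply: continuousD; [exact: Cf|exact: Cg].
move=> [df Cf] [dg Cg]; split=> [u Uu|i].
  by apply: differentiableD; [exact: df|exact: dg].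
apply: (Ck_on_ext oU _ (IH _ _ (Cf i) (Cg i))) => u /set_mem Uu /=.
by rewrite /partial -deriveD //; apply: diff_derivable; [exact: df|exact: dg].
Qed.

Lemma Ck_on_sum (W : normedModType R) k (U : set 'rV[R]_n) (I : Type) (r : seq I)
    (f : I -> 'rV[R]_n -> W) :
  open U -> (forall i, Ck_on k U (f i)) ->
  Ck_on k U (fun u => \sum_(i <- r) f i u).
Proof.
move=> oU Cf; elim: r => [|i r IH].
  by under eq_fun do rewrite big_nil; exact: Ck_on_cst.
under eq_fun do rewrite big_cons.
exact: Ck_onD.
Qed.

Lemma partialM i (f g : 'rV[R]_n -> R) u :
  differentiable (f : _ -> R^o) u -> differentiable (g : _ -> R^o) u ->
  partial (W := R^o) i (fun v => f v * g v) u =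
    f u * partial (W := R^o) i g u + g u * partial (W := R^o) i f u :> R.
Proof.
move=> df dg.
exact: (@deriveM R _ f g u _ (diff_derivable df) (diff_derivable dg)).
Qed.

Lemma Ck_onM k (U : set 'rV[R]_n) (f g : 'rV[R]_n -> R) :
  open U -> Ck_on (W := R^o) k U f -> Ck_on (W := R^o) k U g ->
  Ck_on (W := R^o) k U (fun u => f u * g u).
Proof.
move=> oU; elim: k f g => [|k IH] f g.
  by move=> Cf Cg u Uu; apply: (@continuousM _ _ f g); [exact: Cf|exact: Cg].
move=> Cf Cg; have [df C'f] := Cf; have [dg C'g] := Cg; split=> [u Uu|i].
  exact: (differentiableM (df u Uu) (dg u Uu)).
have CD := Ck_onD oU (IH _ _ (Ck_onS Cf) (C'g i)) (IH _ _ (Ck_onS Cg) (C'f i)).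
apply: (Ck_on_ext oU _ CD) => u /set_mem Uu.
by rewrite partialM; [|exact: df|exact: dg].
Qed.

Lemma partial_coord m (F : 'rV[R]_n -> 'rV[R]_m) i a u :
  differentiable F u ->
  partial (W := R^o) i (fun v => F v 0 a) u = partial i F u 0 a.
Proof.
by move=> dF; rewrite /partial derive_mx ?mxE //; exact: diff_derivable.
Qed.

Lemma Ck_on_coord k m (U : set 'rV[R]_n) (F : 'rV[R]_n -> 'rV[R]_m) a :
  open U -> Ck_on k U F -> Ck_on (W := R^o) k U (fun v => F v 0 a).
Proof.
move=> oU; elim: k F => [|k IH] F /=.
  move=> CF u Uu; apply: (@continuous_comp _ _ _ F (fun N : 'rV[R]_m => N 0 a : R)).
    exact: CF.
  exact: coord_continuous.
case=> dF CF; split=> [u Uu|i].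
  apply: (@differentiable_comp _ _ _ _ F (fun N : 'rV[R]_m => N 0 a : R^o)).
    exact: dF.
  exact: differentiable_coord.
apply: (Ck_on_ext oU _ (IH _ (CF i))) => u /set_mem Uu /=.
by rewrite partial_coord //; exact: dF.
Qed.

End Ck.

Lemma diff_partial (R : realType) n (W : normedModType R) (f : 'rV[R]_n -> W) u v :
  differentiable f u -> 'd f u v = \sum_(i < n) v 0 i *: partial i f u.
Proof.
move=> df; rewrite [in LHS](row_sum_delta v) linear_sum.
by apply: eq_bigr => i _; rewrite linearZ /= /partial deriveE.
Qed.

Lemma partial_comp (R : realType) n m (W : normedModType R) (h : 'rV[R]_m -> W)
    (F : 'rV[R]_n -> 'rV[R]_m) i u :
  differentiable F u -> differentiable h (F u) ->
  partial i (h \o F) u = \sum_(a < m) partial i F u 0 a *: partial a h (F u).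
Proof.
move=> dF dh; rewrite {1}/partial deriveE; last exact: differentiable_comp.
rewrite diff_comp; [|exact: dF|exact: dh].
rewrite [LHS]/= diff_partial; last exact: dh.
by rewrite -deriveE.
Qed.

Lemma Ck_on_comp (R : realType) n m k (U : set 'rV[R]_n) (V : set 'rV[R]_m)
    (h : 'rV[R]_m -> R^o) (F : 'rV[R]_n -> 'rV[R]_m) :
  open U -> (forall u, U u -> V (F u)) -> Ck_on k V h -> Ck_on k U F ->
  Ck_on k U (h \o F).
Proof.
move=> oU UV; elim: k h => [|k IH] h.
  move=> Ch CF u Uu; apply: continuous_comp; first exact: CF.
  by apply: Ch; exact: UV.
move=> [dh Ch] CF; have [dF C'F] := CF; split=> [u Uu|i].
  by apply: differentiable_comp; [exact: dF|apply: dh; exact: UV].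
have CS : Ck_on (W := R^o) k U (fun u => \sum_(a < m) (partial i F u 0 a *
    partial (W := R^o) a h (F u) : R)).
  apply: Ck_on_sum => // a; apply: Ck_onM => //.
    by apply: Ck_on_coord => //; exact: C'F.
  by apply: IH (Ck_onS CF); exact: Ch.
apply: (Ck_on_ext oU _ CS) => u /set_mem Uu.
by rewrite [RHS]partial_comp; [|exact: dF|apply: dh; exact: UV].
Qed.

(** * Mean value theorem along lines and symmetry of mixed partial derivatives *)

Lemma is_derive_line (R : realType) (V : normedModType R) (g : V -> R^o)
    (w e : V) (r : R) : differentiable g (w + r *: e) ->
  is_derive r 1 (fun r : R => g (w + r *: e)) ('D_e g (w + r *: e)).
Proof.
move=> dg.
have dl : is_diff r (fun r : R => w + r *: e) (fun s => s *: e).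
  (* The zero summand is the differential of the constant [w]; it gives the goal the shape of the
     sum rule. *)
  have -> : (fun s : R => s *: e) = (0 : R -> V) + (fun s => s *: e).
    by rewrite add0r.
  exact: is_diffD.
have [dg' _] := differentiableP dg.
have dc := differentiable_comp (ex_diff (is_diff_def := dl)) dg.
apply: DeriveDef; first exact: diff_derivable dc.
rewrite deriveE // diff_comp //= (diff_val (is_diff_def := dl)) scale1r.
by rewrite deriveE.
Qed.

Lemma MVT_line (R : realType) (V : normedModType R) (g : V -> R^o)
    (w e : V) (h : R) : 0 < h ->
  (forall s, 0 <= s <= h -> differentiable g (w + s *: e)) ->
  exists2 s, 0 <= s <= h & g (w + h *: e) - g w = h * 'D_e g (w + s *: e).
Proof.
move=> h0 dg; pose phi (r : R) : R := g (w + r *: e).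
have [|||s + phiE] := @MVT_segment R phi (fun s => 'D_e g (w + s *: e)) 0 h.
- exact: ltW.
- move=> s; rewrite in_itv /= => /andP[s0 sh]; apply: is_derive_line.
  by apply: dg; rewrite !ltW.
- apply: derivable_within_continuous => s; rewrite in_itv /= => sh.
  by case: (is_derive_line (dg s sh)).
rewrite in_itv /= => sh; exists s => //.
by move: phiE; rewrite /phi scale0r addr0 subr0 mulrC.
Qed.

(* The mean value theorem, applied along [e_i] to the first difference in the
   direction [e_j], then along [e_j]. *)
Lemma second_difference (R : realType) n (U : set 'rV[R]_n)
    (f : 'rV[R]_n -> R^o) (u : 'rV[R]_n) (i j : 'I_n) (h : R) :
  0 < h -> (forall s t : R, 0 <= s <= h -> 0 <= t <= h ->
    U (u + s *: delta_mx 0 i + t *: delta_mx 0 j)) ->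
  Ck_on 2 U f ->
  exists s t : R, [/\ 0 <= s <= h, 0 <= t <= h &
    f (u + h *: delta_mx 0 i + h *: delta_mx 0 j) - f (u + h *: delta_mx 0 i)
    - (f (u + h *: delta_mx 0 j) - f u) =
    h * (h * partial j (partial i f)
               (u + s *: delta_mx 0 i + t *: delta_mx 0 j))].
Proof.
move=> h0 hU [df Cf].
set ei := delta_mx 0 i; set ej := delta_mx 0 j.
have hh : 0 <= h <= h by apply/andP; split; [exact: ltW|exact: lexx].
have h00 : 0 <= (0 : R) <= h by apply/andP; split; [exact: lexx|exact: ltW].
pose G (v : 'rV[R]_n) : R^o := f (v + h *: ej) - f v.
have U0 (s : R) : 0 <= s <= h -> U (u + s *: ei).
  by move=> sh; have := hU s 0 sh h00; rewrite scale0r addr0.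
have dS (v : 'rV[R]_n) : differentiable f (v + h *: ej) ->
    is_diff v (fun v => f (v + h *: ej)) ('d f (v + h *: ej)).
  move=> dfv.
  have dsh : is_diff v (fun v : 'rV[R]_n => v + h *: ej) id.
    have -> : (id : 'rV[R]_n -> _) = id + (0 : 'rV[R]_n -> 'rV[R]_n).
      by rewrite addr0.
    exact: is_diffD.
  exact: (is_diff_comp dsh (differentiableP dfv)).
have dG (s : R) : 0 <= s <= h -> is_diff (u + s *: ei) G
    (('d f (u + s *: ei + h *: ej) : 'rV[R]_n -> R^o)
     - ('d f (u + s *: ei) : 'rV[R]_n -> R^o)).
  move=> sh; apply: is_diffB; first by apply: dS; apply: df; exact: hU.
  by apply: differentiableP; apply: df; exact: U0.
have [|s sh GE] := @MVT_line _ _ G u ei h h0.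
  by move=> s sh; exact: (ex_diff (is_diff_def := dG s sh)).
have [|t th fE] := @MVT_line _ _ (partial i f) (u + s *: ei) ej h h0.
  by move=> t th; apply: (proj1 (Cf i)); exact: hU.
exists s, t; split=> //; rewrite [LHS]GE; congr (h * _).
(* The derivative of [G] along [ei] is the increment of [partial i f] over the step [h *: ej], which
   [fE] evaluates. *)
rewrite deriveE; last exact: (ex_diff (is_diff_def := dG s sh)).
have -> := diff_val (is_diff_def := dG s sh).
apply: etrans fE; rewrite /partial; congr (_ - _); apply/esym/deriveE/df.
  exact: hU.
exact: U0.
Qed.

Lemma near_parallelogram (R : realType) (V : normedModType R) (u e e' : V)
    (P : V -> Prop) : (\forall v \near u, P v) ->
  \forall h \near 0^'+, forall s t : R,
    0 <= s <= h -> 0 <= t <= h -> P (u + s *: e + t *: e').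
Proof.
move=> /nbhs_normP[r /= r0 rP].
near=> h => s t /andP[s0 sh] /andP[t0 th]; apply: rP.
rewrite /ball_ /= -addrA opprD addNKr normrN.
have h0 : 0 < h by near: h; exact: nbhs_right_gt.
apply: (@le_lt_trans _ _ (h * (`|e| + `|e'|))).
  rewrite mulrDr (le_trans (ler_normD _ _)) // lerD //.
    by rewrite normrZ ger0_norm // ler_wpM2r.
  by rewrite normrZ ger0_norm // ler_wpM2r.
(* The added 1 keeps the coming divisor positive even when [e] and [e'] both vanish. *)
apply: (@le_lt_trans _ _ (h * (`|e| + `|e'| + 1))).
  by apply: ler_wpM2l; [exact: ltW|rewrite lerDl].
rewrite -ltr_pdivlMr; last by rewrite ltr_wpDl // addr_ge0.
near: h; apply: nbhs_right_lt; rewrite divr_gt0 //.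
Unshelve. all: by end_near. Qed.

(** A second difference over a small square yields each mixed derivative at some point of the
    square; continuity of both at [u] then bounds their difference there by any [e], one half for
    each. *)
Lemma schwarz (R : realType) n (U : set 'rV[R]_n) (f : 'rV[R]_n -> R^o) i j u :
  open U -> U u -> Ck_on 2 U f ->
  partial j (partial i f) u = partial i (partial j f) u.
Proof.
move=> oU Uu Cf; have [_ Cf'] := Cf.
have cD k l : {for u, continuous (partial l (partial k f))}.
  by have [_ C2] := Cf' k; exact: (C2 l u Uu).
apply/eqP; rewrite -subr_eq0 -normr_eq0 eq_le normr_ge0 andbT.
apply/ler_addgt0Pl => e e0; rewrite addr0.
have e2 : 0 < e / 2 by rewrite divr_gt0.
pose P k l v := U v /\
  `|partial l (partial k f) u - partial l (partial k f) v| < e / 2.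
have nP k l : \forall v \near u, P k l v.
  near=> v; split; first by near: v; exact: open_nbhs_nbhs.
  by near: v; have /cvgrPdist_lt/(_ _ e2) := cD k l.
pose H k l (h : R) := forall s t : R, 0 <= s <= h -> 0 <= t <= h ->
  P k l (u + s *: delta_mx 0 k + t *: delta_mx 0 l).
have nH k l : \forall h \near 0^'+, H k l h.
  by apply: (near_parallelogram _ _ (nP k l)).
have nH2 : \forall h \near 0^'+, H i j h /\ H j i h.
  exact: filterI (nH i j) (nH j i).
near (0 : R)^'+ => h.
have h0 : 0 < h by near: h; exact: nbhs_right_gt.
have [hP1 hP2] : H i j h /\ H j i h by near: h; exact: nH2.
have [|s [t [sh th E1]]] := @second_difference _ _ U f u i j h h0 _ Cf.
  by move=> s t sh th; exact: (hP1 s t sh th).1.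
have [|s' [t' [sh' th' E2]]] := @second_difference _ _ U f u j i h h0 _ Cf.
  by move=> s' t' sh' th'; exact: (hP2 s' t' sh' th').1.
have [_ HA] := hP1 s t sh th; have [_ HB] := hP2 s' t' sh' th'.
(* The second difference is symmetric in [i] and [j], so [E1] and [E2] evaluate the same number;
   cancelling [h] twice equates the two mixed derivatives, each at its own intermediate point. *)
move: E1; rewrite (addrAC u (h *: delta_mx 0 i)).
rewrite [LHS](_ : _ = h * (h * partial i (partial j f)
    (u + s' *: delta_mx 0 j + t' *: delta_mx 0 i))); last first.
  by rewrite -E2; ring.
move=> /(mulfI (lt0r_neq0 h0))/(mulfI (lt0r_neq0 h0)) AB.
rewrite AB in HB; rewrite (splitr e) -(subrKA (partial j (partial i f)
  (u + s *: delta_mx 0 i + t *: delta_mx 0 j))).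
apply: (le_trans (ler_normD _ _)); rewrite [X in _ + X]distrC.
by apply: lerD; [exact: (ltW HA)|exact: (ltW HB)].
Unshelve. all: by end_near. Qed.

(** * Multilinear algebra in coordinates *)

(** Tensor fields are bare functions with a linearity property, so sums are taken out by hand. For
    the empty sum, linearity with coefficient -1 at 0 gives [f 0 = 0]. *)
Lemma scalar_lincomb (R : pzRingType) (V : lmodType R) (f : V -> R) (I : Type)
    (r : seq I) (a : I -> R) (e : I -> V) :
  scalar f -> f (\sum_(i <- r) a i *: e i) = \sum_(i <- r) a i * f (e i).
Proof.
move=> lf; elim: r => [|i r IH]; last by rewrite !big_cons lf IH.
by rewrite !big_nil; have := lf (-1) 0 0; rewrite scaler0 addr0 mulN1r addNr.
Qed.

Lemma linear_lincomb (R : pzRingType) (V W : lmodType R) (f : V -> W) (I : Type)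
    (r : seq I) (a : I -> R) (e : I -> V) :
  linear f -> f (\sum_(i <- r) a i *: e i) = \sum_(i <- r) a i *: f (e i).
Proof.
move=> lf; elim: r => [|i r IH]; last by rewrite !big_cons lf IH.
by rewrite !big_nil; have := lf (-1) 0 0; rewrite scaler0 addr0 scaleN1r addNr.
Qed.

(** A row [a] killed by the Gram matrix gives a vector [w] orthogonal to every [e j], hence to
    itself, so [w = 0] by positivity. This serves both the metric in a chart and the metric
    restricted to the image of a tangent space. *)
Lemma gram_unitmx (R : realFieldType) (V : lmodType R) (B : V -> V -> R) n
    (e : 'I_n -> V) :
  (forall v, scalar (B v) /\ scalar (B ^~ v)) -> (forall v, v != 0 -> 0 < B v v) ->
  (forall a : 'rV_n, \sum_(i < n) a 0 i *: e i = 0 -> a = 0) ->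
  (\matrix_(i < n, j < n) B (e i) (e j)) \in unitmx.
Proof.
move=> lB pB free; rewrite -row_free_unit; apply: inj_row_free => a aG0.
apply: free; apply/eqP; apply: contraT => /pB; set w := \sum_(i < n) _.
suff -> : B w w = 0 by rewrite ltxx.
rewrite {2}/w scalar_lincomb; last exact: (lB w).1.
rewrite big1 // => j _; suff -> : B w (e j) = (a *m \matrix_(i, j) B (e i) (e j)) 0 j.
  by rewrite aG0 mxE mulr0.
rewrite /w (@scalar_lincomb _ _ (B ^~ (e j))); last exact: (lB (e j)).2.
by rewrite mxE; apply: eq_bigr => i _; rewrite mxE.
Qed.

(* If [om = g(., J .)] in coordinates, the hypotheses on [Gam] say that it is
   symmetric and metric, and [hJ] that [J] is parallel: hence [om] is parallel. *)
Lemma parallel_form (R : comPzRingType) n (G : 'I_n -> 'I_n -> R)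
    (J : 'I_n -> 'I_n -> R) (dG dJ Gam : 'I_n -> 'I_n -> 'I_n -> R)
    (om := fun a b => \sum_(l < n) G a l * J l b) :
  (forall a b, G a b = G b a) ->
  (forall k i p, dG k i p =
     \sum_(q < n) G i q * Gam q k p + \sum_(q < n) G p q * Gam q k i) ->
  (forall i l j, dJ i l j +
     \sum_(k < n) (Gam l i k * J k j - Gam k i j * J l k) = 0) ->
  forall k i j, \sum_(l < n) (dG k i l * J l j + G i l * dJ k l j) =
    \sum_(q < n) (Gam q k i * om q j + Gam q k j * om i q).
Proof.
move=> Gs hG hJ k i j.
(* Of the four terms produced by [hG] and [hJ], the two in the last bracket contract [G i], [Gam]
   and [J] in the same way and differ only by the names of the summation indices. *)
have -> : \sum_(l < n) (dG k i l * J l j + G i l * dJ k l j) =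
  \sum_(l < n) \sum_(q < n) (G l q * Gam q k i * J l j + Gam q k j * (G i l * J l q))
  + (\sum_(l < n) \sum_(q < n) G i q * Gam q k l * J l j -
     \sum_(l < n) \sum_(q < n) G i l * Gam l k q * J q j).
  rewrite -sumrB -big_split; apply: eq_bigr => l _ /=.
  have -> : dJ k l j = - (\sum_(p < n) Gam l k p * J p j -
      \sum_(p < n) Gam p k j * J l p).
    by apply/eqP; rewrite -addr_eq0 -sumrB; apply/eqP; exact: hJ.
  rewrite hG big_split /= -!mulr_suml.
  rewrite [X in _ + X + _](_ : _ = G i l * \sum_(p < n) Gam p k j * J l p).
    rewrite [X in _ + (_ - X)](_ : _ = G i l * \sum_(p < n) Gam l k p * J p j).
      by ring.
    by rewrite mulr_sumr; apply: eq_bigr => p _; ring.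
  by rewrite mulr_sumr; apply: eq_bigr => p _; ring.
rewrite [X in _ + (X - _)]exchange_big /= subrr addr0 exchange_big /=.
apply: eq_bigr => q _; rewrite big_split /= /om !mulr_sumr.
by congr (_ + _); apply: eq_bigr => l _; rewrite // (Gs l q); ring.
Qed.

(** In the cyclic sum each connection term occurs twice, with its lower indices exchanged and the
    arguments of [om] reversed, so the two copies cancel. *)
Lemma parallel_form_closed (R : comPzRingType) n (om : 'I_n -> 'I_n -> R)
    (dom Gam : 'I_n -> 'I_n -> 'I_n -> R) :
  (forall a b, om a b = - om b a) -> (forall l i j, Gam l i j = Gam l j i) ->
  (forall k i j, dom k i j =
     \sum_(q < n) (Gam q k i * om q j + Gam q k j * om i q)) ->
  forall i j k, dom i j k + dom j k i + dom k i j = 0.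
Proof.
move=> oma Gs dE i j k; rewrite !dE -!big_split /= big1 // => q _.
rewrite (Gs q j i) (Gs q k i) (Gs q k j) (oma j q) (oma k q) (oma i q); ring.
Qed.

(* [H i j a] stands for the second derivatives of the map, [F i a] for the first
   ones; closedness passes to the pullback because [H] is symmetric. *)
Lemma pullback_closed (R : comPzRingType) n m (F : 'I_n -> 'I_m -> R)
    (H : 'I_n -> 'I_n -> 'I_m -> R) (om : 'I_m -> 'I_m -> R)
    (dom : 'I_m -> 'I_m -> 'I_m -> R)
    (D := fun i j k => \sum_(a < m) \sum_(b < m)
       ((H i j a * F k b + F j a * H i k b) * om a b +
         F j a * F k b * \sum_(c < m) F i c * dom c a b)) :
  (forall a b, om a b = - om b a) -> (forall i j a, H i j a = H j i a) ->
  (forall a b c, dom a b c + dom b c a + dom c a b = 0) ->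
  forall i j k, D i j k + D j k i + D k i j = 0.
Proof.
move=> oma Hs domc i j k.
(* [T] gathers the second derivatives and is symmetric in its first two indices, so the differences
   [T i j k - T i k j] cancel cyclically. [E] gathers the derivatives of [om]; after renaming sums,
   its three cyclic instances share the factor [F i c * F j a * F k b], leaving the closedness of
   [om]. *)
pose T i j k := \sum_(a < m) \sum_(b < m) H i j a * F k b * om a b.
pose E i j k := \sum_(c < m) \sum_(a < m) \sum_(b < m)
  F i c * F j a * F k b * dom c a b.
have DE i' j' k' : D i' j' k' = T i' j' k' - T i' k' j' + E i' j' k'.
  rewrite /D /T /E [X in _ - X]exchange_big /= [X in _ + X]exchange_big /=.
  rewrite -sumrB -big_split; apply: eq_bigr => a _ /=.
  rewrite [X in _ + X]exchange_big /= -sumrB -big_split; apply: eq_bigr => b _ /=.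
  rewrite mulr_sumr mulrDl (oma b a) mulrN opprK; congr (_ + _ + _).
    by rewrite (mulrC (F j' a)).
  by apply: eq_bigr => c _; ring.
have TS i' j' k' : T i' j' k' = T j' i' k'.
  by apply: eq_bigr => a _; apply: eq_bigr => b _; rewrite Hs.
have E0 : E i j k + E j k i + E k i j = 0.
  have -> : E j k i = \sum_(c < m) \sum_(a < m) \sum_(b < m)
      F i c * F j a * F k b * dom a b c.
    rewrite /E; under eq_bigr do rewrite exchange_big /=.
    rewrite exchange_big /=; apply: eq_bigr => c _; apply: eq_bigr => a _.
    by apply: eq_bigr => b _; ring.
  have -> : E k i j = \sum_(c < m) \sum_(a < m) \sum_(b < m)
      F i c * F j a * F k b * dom b c a.
    rewrite /E exchange_big /=; apply: eq_bigr => c _; rewrite exchange_big /=.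
    by apply: eq_bigr => a _; apply: eq_bigr => b _; ring.
  rewrite -!big_split big1 // => c _ /=; rewrite -!big_split big1 // => a _ /=.
  by rewrite -!big_split big1 // => b _ /=; rewrite -!mulrDr domc mulr0.
rewrite !DE (TS j i k) (TS k i j) (TS k j i) -[RHS]E0; ring.
Qed.

(** Transposition preserves the determinant, while the sign change multiplies it by -1 in odd
    size. *)
Lemma antisymmetric_odd_singular (R : numFieldType) n (A : 'M[R]_n) :
  odd n -> A^T = - A -> \det A = 0.
Proof.
move=> n_odd AT; have := det_tr A.
rewrite AT -scaleN1r detZ -signr_odd n_odd expr1 mulN1r => /eqP.
by rewrite -subr_eq0 -opprD oppr_eq0 -mulr2n mulrn_eq0 => /eqP.
Qed.

(** * Charts and tangent maps *)

Section Charts.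
Context {R : realType} {n : nat}.

Lemma chart_near (T : topologicalType) (c : chart R n T) x (A : set T) :
  is_chart c -> cdom c x -> nbhs x A ->
  \forall u \near c x, cimage c u /\ A (cinv c u).
Proof.
move=> [_ oi cK _ ci] cx xA.
have cix : cimage c (c x) by exists x.
have n1 : nbhs (c x) (cimage c) by exact: open_nbhs_nbhs.
have n2 : nbhs (c x) (cinv c @^-1` A).
  by have := ci _ cix; rewrite /prop_for /continuous_at cK //; apply.
exact: filterI n1 n2.
Qed.

Lemma chart_image_open (T : topologicalType) (c : chart R n T) (A : set T) :
  is_chart c -> open A -> A `<=` cdom c -> open (c @` A).
Proof.
move=> hc oA Ac; rewrite openE => _ [x Ax <-].
have xA : nbhs x A by exact: open_nbhs_nbhs.
have := chart_near hc (Ac _ Ax) xA; apply: filterS => _ [[y cy <-]].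
by case: hc => _ _ cK _ _; rewrite cK // => Ay; exists y.
Qed.

Variable M : manifold R n.
Implicit Types (c : chart R n M) (x : M).

(** The axioms of [manifold] are unnamed record fields; this lemma and the next three recover them
    by destructing. *)
Lemma atlas_is_chart c : atlas c -> is_chart c.
Proof. by case: M c => T A ca ? ? ? h ? ? ? c; exact: h. Qed.

Lemma atlas_smooth c c' : atlas c -> atlas c' -> smooth_transition c c'.
Proof. by case: M c c' => T A ca ? ? ? ? h ? ? c c'; exact: h. Qed.

Lemma chart_at_atlas x : atlas (chart_at x).
Proof. by case: M x => T A ca ? ? ? ? ? h ? x; exact: h. Qed.

Lemma chart_at_dom x : cdom (chart_at x) x.
Proof. by case: M x => T A ca ? ? ? ? ? ? h x; exact: h. Qed.

Lemma cinvK c x : atlas c -> cdom c x -> cinv c (c x) = x.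
Proof. by move=> /atlas_is_chart[_ _ cK _ _] /cK. Qed.

Lemma cdom_nbhs c x : atlas c -> cdom c x -> nbhs x (cdom c).
Proof. by move=> /atlas_is_chart[oc _ _ _ _] cx; exact: open_nbhs_nbhs. Qed.

Lemma transition_differentiable c c' x : atlas c -> atlas c' ->
  cdom c x -> cdom c' x -> differentiable (c' \o cinv c) (c x).
Proof.
move=> ac ac' cx c'x; have [+ _] := atlas_smooth ac ac' 1.
by apply; exists x.
Qed.

(** The two transition maps compose to the identity near [c x], and only there since [cinv] is
    unconstrained elsewhere; the chain rule does the rest. *)
Lemma transitionK c c' x v : atlas c -> atlas c' -> cdom c x -> cdom c' x ->
  'd (c \o cinv c') (c' x) ('d (c' \o cinv c) (c x) v) = v.
Proof.
move=> ac ac' cx c'x.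
have idE : {near c x, (c \o cinv c') \o (c' \o cinv c) =1 id}.
  have := chart_near (atlas_is_chart ac) cx (cdom_nbhs ac' c'x).
  apply: filterS => _ [[y cy <-]] /=.
  by rewrite (cinvK ac cy) => c'y; rewrite (cinvK ac' c'y).
have pE : (c' \o cinv c) (c x) = c' x by rewrite /= cinvK.
have := diff_comp_near pE (transition_differentiable ac ac' cx c'x)
  (transition_differentiable ac' ac c'x cx) idE.
move=> /(congr1 (fun h : 'rV[R]_n -> 'rV[R]_n => h v)) dE.
apply: etrans (esym dE) _.
have dI : 'd id (c x) = id :> ('rV[R]_n -> 'rV[R]_n).
  exact: (diff_val (is_diff_def := is_diff_id (c x))).
exact: (congr1 (fun h : 'rV[R]_n -> 'rV[R]_n => h v) dI).
Qed.

Lemma coord_coord_vec c x i : atlas c -> cdom c x ->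
  coord c (coord_vec c x i) = delta_mx 0 i.
Proof.
move=> ac cx; apply: transitionK => //; [exact: chart_at_atlas|exact: chart_at_dom].
Qed.

Lemma coord_vec_sum c x (v : tangent x) : atlas c -> cdom c x ->
  v = \sum_(i < n) coord c v 0 i *: coord_vec c x i.
Proof.
move=> ac cx; have acx := chart_at_atlas x; have cxx := chart_at_dom x.
rewrite -[LHS](transitionK v acx ac cxx cx) diff_partial; last first.
  exact: transition_differentiable.
apply: eq_bigr => i _; congr (_ *: _); rewrite /partial deriveE //.
exact: transition_differentiable.
Qed.

Lemma coord_linear c x : linear (@coord R n M c x).
Proof. by move=> a u v; rewrite /coord linearP. Qed.

Lemma coord_lincomb c x (a : 'rV[R]_n) : atlas c -> cdom c x ->
  coord c (\sum_(i < n) a 0 i *: coord_vec c x i : tangent x) = a.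
Proof.
move=> ac cx; rewrite (linear_lincomb _ _ _ (@coord_linear c x)).
rewrite [RHS]row_sum_delta; apply: eq_bigr => i _; congr (_ *: _).
exact: coord_coord_vec.
Qed.

Lemma coord_vec_free c x (a : 'rV[R]_n) : atlas c -> cdom c x ->
  \sum_(i < n) a 0 i *: coord_vec c x i = 0 -> a = 0.
Proof.
move=> ac cx a0; rewrite -(coord_lincomb a ac cx) a0.
by rewrite /coord linear0.
Qed.

End Charts.

Section TangentMap.
Context {R : realType} {n m : nat} (N : manifold R n) (M : manifold R m).
Variables (f : N -> M).
Hypothesis sf : smooth_map f.

Lemma local_rep_dom_open (c : chart R n N) (c' : chart R m M) :
  atlas c -> atlas c' -> open (c @` (cdom c `&` f @^-1` cdom c')).
Proof.
move=> ac ac'; have hc := atlas_is_chart ac; have hc' := atlas_is_chart ac'.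
apply: chart_image_open => //.
have [oc _ _ _ _] := hc; have [oc' _ _ _ _] := hc'.
by apply: openI => //; apply: open_comp oc' => x _; exact: sf.1.
Qed.

Lemma local_rep_differentiable (c : chart R n N) (c' : chart R m M) x :
  atlas c -> atlas c' -> cdom c x -> cdom c' (f x) ->
  differentiable (c' \o f \o cinv c) (c x).
Proof.
by move=> ac ac' cx c'x; have [+ _] := sf.2 _ _ ac ac' 1; apply; exists x.
Qed.

(** The representative of [f] from [c] to [chart_at (f x)] factors near [c x] both through
    [chart_at x] and through [c']. The chain rule on the first factorization gives the left side, on
    the second the right side. *)
Lemma tmap_coord_vec (c : chart R n N) (c' : chart R m M) (x : N) i :
  atlas c -> atlas c' -> cdom c x -> cdom c' (f x) ->
  tmap f (coord_vec c x i) =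
    \sum_(a < m) partial i (c' \o f \o cinv c) (c x) 0 a *: coord_vec c' (f x) a.
Proof.
move=> ac ac' cx c'fx.
have acx := chart_at_atlas x; have cxx := chart_at_dom x.
have acf := chart_at_atlas (f x); have cff := chart_at_dom (f x).
set cX := chart_at x; set cF := chart_at (f x).
have near_rep (A : set M) : nbhs (f x) A ->
    \forall u \near c x, cimage c u /\ A (f (cinv c u)).
  move=> fxA; have fA : nbhs x (f @^-1` A) by exact: (sf.1 x).
  exact: chart_near (atlas_is_chart ac) cx fA.
have E1 : 'd (cF \o f \o cinv c) (c x) =
    'd (cF \o f \o cinv cX) (cX x) \o 'd (cX \o cinv c) (c x)
      :> ('rV[R]_n -> 'rV[R]_m).
  have pE : (cX \o cinv c) (c x) = cX x by rewrite /= cinvK.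
  apply: (diff_comp_near pE).
  - exact: transition_differentiable.
  - exact: local_rep_differentiable.
  - have := chart_near (atlas_is_chart ac) cx (cdom_nbhs acx cxx).
    by apply: filterS => u [_ cXu] /=; rewrite cinvK.
have E2 : 'd (cF \o f \o cinv c) (c x) =
    'd (cF \o cinv c') (c' (f x)) \o 'd (c' \o f \o cinv c) (c x)
      :> ('rV[R]_n -> 'rV[R]_m).
  have pE : (c' \o f \o cinv c) (c x) = c' (f x) by rewrite /= cinvK.
  apply: (diff_comp_near pE).
  - exact: local_rep_differentiable.
  - exact: transition_differentiable.
  - by have := near_rep _ (cdom_nbhs ac' c'fx);
      apply: filterS => u [_ c'u] /=; rewrite cinvK.
rewrite /tmap /coord_vec.
have -> : 'd (cF \o f \o cinv cX) (cX x) ('d (cX \o cinv c) (c x) (delta_mx 0 i)) =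
    'd (cF \o cinv c') (c' (f x)) ('d (c' \o f \o cinv c) (c x) (delta_mx 0 i)).
  exact: (congr1 (fun h : 'rV[R]_n -> 'rV[R]_m => h (delta_mx 0 i))
    (etrans (esym E1) E2)).
have dt : differentiable (cF \o cinv c') (c' (f x)).
  exact: transition_differentiable.
rewrite diff_partial; last exact: dt.
apply: eq_bigr => a _; rewrite /partial; congr (_ 0 a *: _).
  by rewrite deriveE //; exact: local_rep_differentiable.
by rewrite deriveE.
Qed.

Lemma tmap_linear (x : N) : linear (tmap (x := x) f).
Proof. by move=> a u v; rewrite /tmap linearP. Qed.

End TangentMap.

(** * The fundamental form of a Kaehler manifold *)

Lemma partial_sum (R : realType) n m (f : 'I_m -> 'rV[R]_n -> R^o) i u :
  (forall l, differentiable (f l) u) ->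
  partial (W := R^o) i (fun v => \sum_(l < m) f l v) u =
    \sum_(l < m) partial i (f l) u :> R.
Proof.
move=> df; rewrite /partial.
have -> : (fun v => \sum_(l < m) f l v) = \sum_(l < m) f l by rewrite fct_sumE.
by rewrite derive_sum // => l; exact: diff_derivable.
Qed.

Lemma smooth_on_differentiable (R : realType) n (W : normedModType R)
    (U : set 'rV[R]_n) (f : 'rV[R]_n -> W) u :
  smooth_on U f -> U u -> differentiable f u.
Proof. by move=> sf; have [+ _] := sf 1; exact. Qed.

Lemma cimage_dom (R : realType) n (M : manifold R n) (c : chart R n M) u :
  atlas c -> cimage c u -> cdom c (cinv c u) /\ c (cinv c u) = u.
Proof. by move=> ac [x cx <-]; rewrite cinvK. Qed.

Lemma cimage_open (R : realType) n (M : manifold R n) (c : chart R n M) :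
  atlas c -> open (cimage c).
Proof. by case/atlas_is_chart. Qed.

(** The Kaehler form up to sign convention, with [J] in the second slot to match Lambda. *)
Definition fundamental_form (R : realType) n (M : manifold R n) (g : field2 M)
  (J : field11 M) : field2 M := fun x v w => g x v (J x w).

Section Kaehler.
Context {R : realType} {n : nat} (M : manifold R n).
Variables (g : field2 M) (J : field11 M).
Hypothesis hM : kaehler g J.

Let om := fundamental_form g J.

(** This makes the [invmx] inside [christoffel] a genuine inverse rather than a default value. *)
Lemma metric_matrix_unit c u : atlas c -> cimage c u ->
  (\matrix_(a < n, b < n) comp2 c g a b u) \in unitmx.
Proof.
move=> ac cu; have [[bg _ _ pg] _ _ _] := hM.
have [cx _] := cimage_dom ac cu; apply: gram_unitmx.
- by move=> v; exact: bg.
- exact: pg.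
- by move=> a; exact: coord_vec_free.
Qed.

(** Lowering the upper index cancels the inverse metric and leaves the Christoffel symbol of the
    first kind. *)
Lemma christoffel_lower c u k i j : atlas c -> cimage c u ->
  \sum_(l < n) comp2 c g k l u * christoffel g c l i j u =
  2^-1 * (partial (W := R^o) i (comp2 c g k j) u
    + partial (W := R^o) j (comp2 c g k i) u
    - partial (W := R^o) k (comp2 c g i j) u).
Proof.
move=> ac cu; set G := \matrix_(a < n, b < n) comp2 c g a b u.
pose X p := partial (W := R^o) i (comp2 c g p j) u
  + partial (W := R^o) j (comp2 c g p i) u - partial (W := R^o) p (comp2 c g i j) u.
transitivity (2^-1 * (G *m (invmx G *m \col_p X p)) k 0).
  rewrite mxE mulr_sumr; apply: eq_bigr => l _; rewrite [G k l]mxE mxE.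
  rewrite mulrCA; congr (_ * (_ * _)); apply: eq_bigr => p _.
  by rewrite [in RHS]mxE.
by rewrite mulmxA mulmxV ?metric_matrix_unit // mul1mx mxE.
Qed.

Lemma comp2_metric_sym c a b : comp2 c g a b = comp2 c g b a.
Proof. by have [[_ _ sg _] _ _ _] := hM; apply/funext => u; exact: sg. Qed.

Lemma christoffel_sym c l i j u :
  christoffel g c l i j u = christoffel g c l j i u.
Proof.
congr (_ * _); apply: eq_bigr => k _; congr (_ * _).
by rewrite (comp2_metric_sym c j i) [X in X - _]addrC.
Qed.

(** In the sum of the two lowered symbols the derivative along [k] occurs twice, which absorbs the
    factor one half, and the other four terms cancel. *)
Lemma metric_compatible c u k i p : atlas c -> cimage c u ->
  partial (W := R^o) k (comp2 c g i p) u =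
    \sum_(q < n) comp2 c g i q u * christoffel g c q k p u
    + \sum_(q < n) comp2 c g p q u * christoffel g c q k i u :> R.
Proof.
move=> ac cu; rewrite !christoffel_lower // (comp2_metric_sym c p i).
rewrite (comp2_metric_sym c p k) (comp2_metric_sym c i k) -mulrDr.
by field.
Qed.

(** Applying the isometry [J] to both slots moves it from [w] to [v], at the cost of the sign in
    [J (J w) = - w]. *)
Lemma fundamental_form_antisym x v w : om (x := x) v w = - om w v.
Proof.
have [[bg _ sg _] [lJ _ JJ] gJ _] := hM; rewrite /om /fundamental_form.
rewrite -gJ JJ sg -scaleN1r.
have lg := (bg _ (J v)).2.
(* A sum with a single term extracts homogeneity from [scalar]. *)
have := scalar_lincomb [:: tt] (fun=> -1) (fun=> w) lg.
by rewrite !big_seq1 mulN1r sg => ->; rewrite sg.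
Qed.

Lemma comp2_fundamental_form c u a b : atlas c -> cimage c u ->
  comp2 c om a b u = \sum_(l < n) comp2 c g a l u * comp11 c J l b u.
Proof.
move=> ac cu; have [[bg _ _ _] _ _ _] := hM; have [cx _] := cimage_dom ac cu.
rewrite /comp2 /om /fundamental_form.
rewrite [J _](coord_vec_sum _ ac cx) scalar_lincomb; last exact: (bg _ _).1.
by apply: eq_bigr => l _; rewrite mulrC.
Qed.

Lemma fundamental_form_smooth : smooth_field2 om.
Proof.
have [[_ smg _ _] [_ smJ _] _ _] := hM.
move=> c ac i j k; have oc := cimage_open ac.
apply: (@Ck_on_ext _ _ _ _ _
  (fun u => \sum_(l < n) comp2 c g i l u * comp11 c J l j u) _ oc).
  by move=> u /set_mem cu; rewrite comp2_fundamental_form.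
apply: Ck_on_sum => // l; apply: Ck_onM => //; first exact: smg.
exact: smJ.
Qed.

(** In coordinates, this is the vanishing of the covariant derivative of [om]. *)
Lemma partial_fundamental_form c u k i j : atlas c -> cimage c u ->
  partial (W := R^o) k (comp2 c om i j) u =
    \sum_(q < n) (christoffel g c q k i u * comp2 c om q j u +
                  christoffel g c q k j u * comp2 c om i q u) :> R.
Proof.
move=> ac cu; have oc := cimage_open ac.
have [[_ smg _ _] [_ smJ _] _ par] := hM.
have E : {in cimage c, comp2 c om i j =1
    fun u => \sum_(l < n) comp2 c g i l u * comp11 c J l j u}.
  by move=> v /set_mem cv; exact: comp2_fundamental_form.
rewrite (near_eq_partial (W := R^o) k oc E (mem_set cu)).
have dg a b := smooth_on_differentiable (smg c ac a b) cu.
have dJ a b := smooth_on_differentiable (smJ c ac a b) cu.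
rewrite partial_sum => [|l]; last first.
  exact: (differentiableM (dg i l) (dJ l j)).
under eq_bigr => l _ do rewrite (partialM k (dg i l) (dJ l j)) addrC
  [X in X + _]mulrC.
under [RHS]eq_bigr => q _ do rewrite !comp2_fundamental_form //.
apply: (@parallel_form _ _ (fun a b => comp2 c g a b u)
  (fun l j => comp11 c J l j u)
  (fun k a b => partial (W := R^o) k (comp2 c g a b) u)
  (fun k l j => partial (W := R^o) k (comp11 c J l j) u)
  (fun l i j => christoffel g c l i j u)).
- by move=> a b; rewrite comp2_metric_sym.
- by move=> *; exact: metric_compatible.
- by move=> *; exact: par.
Qed.

(** Phrased in an arbitrary chart rather than through [extd2], because the pullback uses it at [F u]
    in a fixed target chart. *)
Lemma fundamental_form_closed c u i j k : atlas c -> cimage c u ->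
  partial (W := R^o) i (comp2 c om j k) u
  + partial (W := R^o) j (comp2 c om k i) u
  + partial (W := R^o) k (comp2 c om i j) u = 0 :> R.
Proof.
move=> ac cu.
apply: (@parallel_form_closed _ _ (fun a b => comp2 c om a b u)
  (fun k a b => partial (W := R^o) k (comp2 c om a b) u)
  (fun l i j => christoffel g c l i j u)).
- by move=> a b; exact: fundamental_form_antisym.
- by move=> l a b; exact: christoffel_sym.
- by move=> *; exact: partial_fundamental_form.
Qed.

End Kaehler.

(** * The slant form *)

(** [schwarz] concerns scalar functions; this carries it to a map with vector values, one coordinate
    at a time. *)
Lemma partial_partial_coord (R : realType) n m (U : set 'rV[R]_n)
    (F : 'rV[R]_n -> 'rV[R]_m) i j a u :
  open U -> U u -> Ck_on 2 U F ->
  partial i (partial j F) u 0 a =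
  partial (W := R^o) i (partial (W := R^o) j (fun v => F v 0 a)) u.
Proof.
move=> oU Uu [dF CF]; rewrite -partial_coord; last exact: (proj1 (CF j) u Uu).
have E : {in U, partial (W := R^o) j (fun v => F v 0 a) =1
    fun v => partial j F v 0 a}.
  by move=> v /set_mem Uv; apply: partial_coord; exact: dF.
by rewrite (near_eq_partial (W := R^o) i oU E (mem_set Uu)).
Qed.

Section SlantForm.
Context {R : realType} {m n : nat} (M : manifold R m).
Variables (g : field2 M) (J : field11 M).
Hypothesis hM : kaehler g J.
Variables (N : manifold R n) (f : N -> M).
Hypothesis hf : immersion f.

Let om := fundamental_form g J.
Let Lam := slant_form g J f.

Lemma fundamental_form_bilinear : bilinear_field om.
Proof.
have [[bg _ _ _] [lJ _ _] _ _] := hM.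
move=> x v; split=> a u w; last exact: (bg _ (J v)).2.
by rewrite /om /fundamental_form lJ (bg _ v).1.
Qed.

Lemma tmap_inj (x : N) (v : tangent x) : tmap f v = 0 -> v = 0.
Proof.
move=> v0; apply: (hf.2 x); rewrite v0.
by rewrite /tmap linear0.
Qed.

Lemma tmap_lincomb (x : N) (v : tangent x) :
  \sum_(i < n) v 0 i *: tmap f (delta_mx 0 i : tangent x) = tmap f v.
Proof.
rewrite -(linear_lincomb _ _ _ (@tmap_linear _ _ _ N M f x)).
by rewrite -row_sum_delta.
Qed.

(** Since [get] meets its specification only when a witness exists, the content is the existence of
    the orthogonal projection. *)
Lemma tangential_componentP (x : N) (v : tangent (f x)) (Z : tangent x) :
  g (v - tmap f (tangential_component g v : tangent x)) (tmap f Z) = 0.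
Proof.
have [[bg _ sg pg] _ _ _] := hM.
set P := [set Y : 'rV[R]_n |
  forall Z : tangent x, @g (f x) (v - tmap f (Y : tangent x)) (tmap f Z) = 0].
suff : P (get P) by apply.
apply: getPex; pose e i : tangent (f x) := tmap f (delta_mx 0 i : tangent x).
pose G := \matrix_(i < n, j < n) @g (f x) (e i) (e j).
have Gu : G \in unitmx.
  apply: (@gram_unitmx _ _ (@g (f x))) => [w|w|a].
  - exact: bg.
  - exact: pg.
  - by rewrite tmap_lincomb; exact: tmap_inj.
(* Normal equations: the row [Y] solves [Y *m G = b] exactly when [tmap f Y] and [v] have the same
   inner product with every [e j]. *)
pose b : 'rV[R]_n := \row_j @g (f x) v (e j).
exists (b *m invmx G) => W; set Y := b *m invmx G.
rewrite -(tmap_lincomb W) scalar_lincomb; last exact: (bg _ _).1.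
rewrite big1 // => j _.
have lg := (bg (f x) (e j)).2.
have -> : @g (f x) (v - tmap f (Y : tangent x)) (e j) =
    b 0 j - @g (f x) (tmap f (Y : tangent x)) (e j).
  rewrite addrC -scaleN1r lg mulN1r addrC; congr (_ - _).
  by rewrite mxE.
rewrite -(tmap_lincomb Y) (@scalar_lincomb _ _ (fun w => @g (f x) w (e j))) //.
suff -> : \sum_(i < n) Y 0 i * @g (f x) (e i) (e j) = b 0 j by rewrite subrr mulr0.
rewrite -[b in RHS](mulmxKV Gu) [RHS]mxE.
by apply: eq_bigr => i _; congr (_ * _); rewrite mxE.
Qed.

Lemma slant_formE (x : N) (V W : tangent x) :
  Lam V W = om (tmap f V) (tmap f W).
Proof.
have [[bg _ sg _] _ _ _] := hM.
rewrite /Lam /slant_form /induced_metric /om /fundamental_form /slantP.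
set v := J (tmap f W); have := tangential_componentP v V.
rewrite addrC -scaleN1r (bg _ _).2 mulN1r addrC => /eqP; rewrite subr_eq0 => /eqP E.
by rewrite sg -E sg.
Qed.

Lemma slant_form_bilinear : bilinear_field Lam.
Proof.
move=> x v; split=> a u w; rewrite !slant_formE tmap_linear.
  exact: (fundamental_form_bilinear _).1.
exact: (fundamental_form_bilinear _).2.
Qed.

(** * The slant form in a pair of charts, as a pullback of the fundamental form *)

Section LocalRep.
Variables (c : chart R n N) (c' : chart R m M).
Hypotheses (ac : atlas c) (ac' : atlas c').

Let F := c' \o f \o cinv c.
Let U := c @` (cdom c `&` f @^-1` cdom c').

Let oU : open U.
Proof. exact: (local_rep_dom_open hf.1 ac ac'). Qed.

Let CF k : Ck_on k U F.
Proof. exact: (hf.1.2 _ _ ac ac' k). Qed.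

Let UF u : U u -> cimage c' (F u).
Proof.
move=> [x [cx c'x] <-]; rewrite /F /= cinvK //.
by exists (f x).
Qed.

Lemma comp2_slant_form u j k : U u ->
  comp2 c Lam j k u = \sum_(a < m) \sum_(b < m)
    partial j F u 0 a * partial k F u 0 b * comp2 c' om a b (F u).
Proof.
move=> [x [cx c'x] uE]; rewrite /comp2.
have cux : cdom c (cinv c u) by rewrite -uE cinvK.
have c'fx : cdom c' (f (cinv c u)) by rewrite -uE cinvK.
have cuE : c (cinv c u) = u by rewrite -uE cinvK.
rewrite slant_formE !(tmap_coord_vec hf.1 _ ac ac' cux c'fx) cuE.
(* The right side lives in the tangent space at [cinv c' (F u)]; the base points must be identified
   before the two sides can be compared. *)
rewrite (_ : cinv c' (F u) = f (cinv c u)); last by rewrite /F /= cinvK.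
rewrite (@scalar_lincomb _ _ (fun w => om w _)); last first.
  exact: (fundamental_form_bilinear _).2.
apply: eq_bigr => a _; rewrite scalar_lincomb; last first.
  exact: (fundamental_form_bilinear _).1.
by rewrite mulr_sumr; apply: eq_bigr => b _; rewrite mulrA.
Qed.

Let term j k a b (u : 'rV[R]_n) : R :=
  partial j F u 0 a * partial k F u 0 b * comp2 c' om a b (F u).

Let Ck_partial k j a : Ck_on (W := R^o) k U (fun u => partial j F u 0 a).
Proof. by apply: Ck_on_coord => //; have [_] := CF k.+1; apply. Qed.

Let Ck_comp k a b : Ck_on (W := R^o) k U (fun u => comp2 c' om a b (F u)).
Proof.
exact: (Ck_on_comp oU UF (fundamental_form_smooth hM ac' a b k) (CF k)).
Qed.

Lemma slant_form_smooth_rep k i j : Ck_on (W := R^o) k U (comp2 c Lam i j).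
Proof.
apply: (@Ck_on_ext _ _ _ _ _ (fun u => \sum_(a < m) \sum_(b < m) term i j a b u)).
- exact: oU.
- by move=> u /set_mem Uu; rewrite comp2_slant_form.
- apply: Ck_on_sum => // a; apply: Ck_on_sum => // b.
  exact: Ck_onM oU (Ck_onM oU (Ck_partial k i a) (Ck_partial k j b))
    (Ck_comp k a b).
Qed.

(** The product and chain rules, arranged in the shape of [D] in [pullback_closed]. *)
Lemma partial_slant_form u i j k : U u ->
  partial (W := R^o) i (comp2 c Lam j k) u = \sum_(a < m) \sum_(b < m)
    ((partial i (partial j F) u 0 a * partial k F u 0 b
      + partial j F u 0 a * partial i (partial k F) u 0 b) * comp2 c' om a b (F u)
     + partial j F u 0 a * partial k F u 0 b * \sum_(d < m)
         partial i F u 0 d * partial (W := R^o) d (comp2 c' om a b) (F u)) :> R.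
Proof.
move=> Uu.
have E : {in U, comp2 c Lam j k =1
    fun u => \sum_(a < m) \sum_(b < m) term j k a b u}.
  by move=> v /set_mem Uv; exact: comp2_slant_form.
have dP l a : differentiable (fun u => partial l F u 0 a : R^o) u.
  by have [+ _] := Ck_partial 1 l a; exact.
have dO a b : differentiable (fun u => comp2 c' om a b (F u) : R^o) u.
  by have [+ _] := Ck_comp 1 a b; exact.
have dPP a b : differentiable
    ((fun u => partial j F u 0 a * partial k F u 0 b : R) : _ -> R^o) u.
  exact: (differentiableM (dP j a) (dP k b)).
have dT a b : differentiable (term j k a b) u.
  exact: (differentiableM (dPP a b) (dO a b)).
rewrite (near_eq_partial (W := R^o) i oU E (mem_set Uu)).
rewrite partial_sum => [|a]; last first.
  rewrite (_ : (fun u => _) = \sum_(b < m) term j k a b); last first.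
    by rewrite fct_sumE.
  exact: differentiable_sum.
apply: eq_bigr => a _; rewrite partial_sum //; apply: eq_bigr => b _.
rewrite (partialM i (dPP a b) (dO a b)) (partialM i (dP j a) (dP k b)).
have dpF l : differentiable (partial l F) u by exact: (proj1 ((CF 2).2 l) u Uu).
have dF : differentiable F u by exact: (CF 1).1.
have dom : differentiable (comp2 c' om a b : _ -> R^o) (F u).
  apply: smooth_on_differentiable (UF Uu); exact: (fundamental_form_smooth hM ac').
have dOE : partial (W := R^o) i (fun u => comp2 c' om a b (F u)) u =
    \sum_(d < m) partial i F u 0 d * partial (W := R^o) d (comp2 c' om a b) (F u) :> R.
  exact: (@partial_comp _ _ _ R^o (comp2 c' om a b) F i u dF dom).
rewrite dOE (partial_coord i a (dpF j)) (partial_coord i b (dpF k)).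
ring.
Qed.

Lemma slant_form_closed_rep u i j k : U u ->
  partial (W := R^o) i (comp2 c Lam j k) u
  + partial (W := R^o) j (comp2 c Lam k i) u
  + partial (W := R^o) k (comp2 c Lam i j) u = 0 :> R.
Proof.
move=> Uu; rewrite !partial_slant_form //.
apply: (@pullback_closed _ _ _ (fun i a => partial i F u 0 a)
  (fun i j a => partial i (partial j F) u 0 a)
  (fun a b => comp2 c' om a b (F u))
  (fun d a b => partial (W := R^o) d (comp2 c' om a b) (F u))).
- by move=> a b; exact: fundamental_form_antisym.
- move=> p q a; have C2 := Ck_on_coord a oU (CF 2).
  exact: etrans (partial_partial_coord p q a oU Uu (CF 2)) (etrans
    (schwarz q p oU Uu C2) (esym (partial_partial_coord q p a oU Uu (CF 2)))).
- by move=> a b d; exact: (fundamental_form_closed hM a b d ac' (UF Uu)).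
Qed.

End LocalRep.

(** The image of [cdom c] need not lie in a single chart of [M], so the target chart is chosen
    separately around each point. *)
Lemma slant_form_smooth : smooth_field2 Lam.
Proof.
move=> c ac i j k; apply: Ck_on_local => _ [x cx <-].
exists (c @` (cdom c `&` f @^-1` cdom (chart_at (f x)))).
  by exists x => //; split=> //; exact: chart_at_dom.
by apply: slant_form_smooth_rep => //; exact: chart_at_atlas.
Qed.

Lemma slant_form_closed (x : N) (X Y Z : tangent x) : extd2 Lam X Y Z = 0.
Proof.
rewrite /extd2; apply: big1 => i _; apply: big1 => j _; apply: big1 => k _.
rewrite (@slant_form_closed_rep (chart_at x) (chart_at (f x))) ?mulr0 //.
- exact: chart_at_atlas.
- exact: chart_at_atlas.
- by exists x => //; split; exact: chart_at_dom.
Qed.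

Lemma slant_form_alternating (x : N) (V : tangent x) : Lam V V = 0.
Proof.
rewrite slant_formE; set t := tmap f V; apply/eqP.
have omE : om t t = - om t t := fundamental_form_antisym hM t t.
by rewrite -[_ == 0](@mulrn_eq0 R _ 2) mulr2n {1}omE addNr.
Qed.

(** * Nondegeneracy and even dimension *)

Hypothesis hs : proper_slant g J f.

Lemma slant_form_nondegenerate (x : N) (X : tangent x) :
  (forall Y, Lam X Y = 0) -> X = 0.
Proof.
move=> X0; have [th [sl _ /eqP thpi]] := hs; apply/eqP; apply: contrapT => Xn0.
apply: thpi; rewrite -(sl x X); last exact/negP.
rewrite /angle_subspace [X in inf X](_ : _ = [set pi / 2]) ?inf1 //.
have aE (Y : tangent x) : angle g (J (tmap f X)) (tmap f Y) = pi / 2.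
  rewrite /angle -acos0; congr acos.
  have [[_ _ sg _] _ _ _] := hM.
  suff -> : g (J (tmap f X)) (tmap f Y) = 0 by rewrite mul0r.
  have := X0 Y; rewrite slant_formE [LHS](fundamental_form_antisym hM) => /eqP.
  by rewrite oppr_eq0 => /eqP; rewrite sg.
apply/seteqP; split=> [_ [_ [[Y _ <-] _] <-]|_ ->]; first exact: aE.
(* The set of angles must be inhabited, as the infimum of the empty set is a default value;
   [tmap f X] is a nonzero tangent direction because [f] is an immersion. *)
exists (tmap f X); last exact: aE.
split; first by exists X.
by apply/eqP => /tmap_inj/eqP.
Qed.

Lemma slant_even : ~~ odd n.
Proof.
(* The parity is read off from a single tangent space, so a point is needed; manifolds are nonempty
   by definition. *)
apply/negP => n_odd; have [x _] : [set: N] !=set0 by case: N.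
pose e i : tangent x := delta_mx 0 i.
pose A := \matrix_(i < n, j < n) Lam (e i) (e j).
have /(antisymmetric_odd_singular n_odd) detA : A^T = - A.
  apply/matrixP => i j; rewrite !mxE !slant_formE.
  exact: fundamental_form_antisym.
have : row_free A.
  (* A row [v] with [v *m A = 0] is a tangent vector orthogonal for Lambda to every basis vector,
     hence to every [Y]. *)
  apply: inj_row_free => v vA0; apply: (@slant_form_nondegenerate x) => Y.
  rewrite [X in Lam X _]row_sum_delta (@scalar_lincomb _ _ (fun w => Lam w Y)); last first.
    exact: (slant_form_bilinear _).2.
  rewrite [Y]row_sum_delta.
  under eq_bigr => i _.
    rewrite scalar_lincomb; last exact: (slant_form_bilinear _).1.
    rewrite mulr_sumr; over.
  rewrite exchange_big big1 //= => j _.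
  transitivity (Y 0 j * (v *m A) 0 j); last by rewrite vA0 mxE mulr0.
  by rewrite mxE mulr_sumr; apply: eq_bigr => i _; rewrite mxE mulrCA.
by rewrite row_free_unit unitmxE detA unitr0.
Qed.

End SlantForm.

Theorem theorem3p4 (R : realType) (m n : nat)
    (M : manifold R m) (g : field2 M) (J : field11 M) (hM : kaehler g J)
    (N : manifold R n) (f : N -> M) (hf : immersion f)
    (hslant : proper_slant g J f) :
  [/\ two_form (slant_form g J f),
      forall (x : N) (X Y Z : tangent x), extd2 (slant_form g J f) X Y Z = 0,
      dR_H2 (dR_class2 (slant_form g J f))
    & symplectic (slant_form g J f)].
Proof.
have tf : two_form (slant_form g J f).
  split; first exact: (slant_form_bilinear hM hf).
    exact: (slant_form_smooth hM hf).
  exact: (slant_form_alternating hM hf).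
have cl := slant_form_closed hM hf.
split=> //; first by exists (slant_form g J f).
split=> //; first exact: (slant_even hM hf hslant).
exact: (slant_form_nondegenerate hM hf hslant).
Qed.
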